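(* Let $G$ and $H$ be arbitrary connected non-trivial graphs where $H$ is not a complete graph. If $tn(G\circ H)=3\cdot tn(G)$, then $tn(H)>2$.
   Context: All graphs are finite, undirected, without loops or multiple edges; a graph is non-trivial if it has at least two vertices. The lexicographic product $G\circ H$ has vertex set $V(G)\times V(H)$, and $(g_1,h_1)$, $(g_2,h_2)$ are adjacent if either $g_1g_2\in E(G)$ or ($g_1=g_2$ and $h_1h_2\in E(H)$). For distinct non-adjacent vertices $u,v$ of a graph $F$, a tolled walk between $u$ and $v$ is a sequence of vertices $u,w_1,\ldots,w_k,v$ with $k\ge 1$ such that $w_iw_{i+1}\in E(F)$ for all $1\le i<k$, $uw_i\in E(F)$ if and only if $i=1$, and $vw_i\in E(F)$ if and only if $i=k$. If $uv\in E(F)$, the only tolled walk between $u$ and $v$ is $u,v$; the only tolled walk from $v$ to $v$ is $v$ itself. The toll interval $T_F(u,v)$ is the set of all vertices lying on some tolled walk between $u$ and $v$. A set $S\subseteq V(F)$ is a toll set of $F$ if $\bigcup_{u,v\in S}T_F(u,v)=V(F)$. The toll number $tn(F)$ is the minimum size of a toll set of $F$. *)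

(* Defs.v *)
From mathcomp Require Import all_boot.
From mathcomp Require Import boolp.

Set Implicit Arguments.
Unset Strict Implicit.
Unset Printing Implicit Defensive.

Record sgraph := SGraph {
  vertex :> finType;
  adj : rel vertex;
  adj_sym : symmetric adj;
  adj_irr : irreflexive adj }.

Definition nontrivial (F : sgraph) : Prop := 2 <= #|F|.

Definition connected (F : sgraph) : Prop :=
  forall u v : F, connect (@adj F) u v.

Definition complete (F : sgraph) : Prop :=
  forall u v : F, u != v -> adj u v.

Section LexProduct.
Variables G H : sgraph.

Definition lex_adj : rel (G * H) :=
  fun x y => adj x.1 y.1 || (x.1 == y.1) && adj x.2 y.2.

Lemma lex_adj_sym : symmetric lex_adj.
Proof. by move=> x y; rewrite /lex_adj adj_sym eq_sym (adj_sym x.2). Qed.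

Lemma lex_adj_irr : irreflexive lex_adj.
Proof. by move=> x; rewrite /lex_adj !adj_irr andbF. Qed.

Definition lex_prod : sgraph := SGraph lex_adj_sym lex_adj_irr.

End LexProduct.

Section Toll.
Variable F : sgraph.

(* The inner vertices of a tolled walk between distinct non-adjacent u and v.
   Indices start at 0, so w_1 is nth u w 0 and w_k is nth u w (size w).-1;
   the default value of nth is never reached. *)
Definition tolled_inner (u v : F) (w : seq F) : Prop :=
  [/\ 1 <= size w,
      forall i, i.+1 < size w -> adj (nth u w i) (nth u w i.+1),
      forall i, i < size w -> (adj u (nth u w i) <-> i = 0)
    & forall i, i < size w -> (adj v (nth u w i) <-> i = (size w).-1)].

(* p is the whole walk, endpoints included. *)
Definition tolled_walk (u v : F) (p : seq F) : Prop :=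
  if u == v then p = [:: v]
  else if adj u v then p = [:: u; v]
  else exists2 w, p = u :: rcons w v & tolled_inner u v w.

Definition toll_interval (u v : F) : {set F} :=
  [set x | `[< exists2 p, tolled_walk u v p & x \in p >]].

Definition toll_set (S : {set F}) : bool :=
  \bigcup_(u in S) \bigcup_(v in S) toll_interval u v == [set: F].

Lemma toll_setT : toll_set [set: F].
Proof.
apply/eqP/setP => x; rewrite in_setT.
apply/bigcupP; exists x => //; apply/bigcupP; exists x => //.
rewrite inE; apply/asboolP; exists [:: x]; last by rewrite inE.
by rewrite /tolled_walk eqxx.
Qed.

(* By toll_setT, the condition of the arg min is satisfiable. *)
Definition toll_number : nat :=
  #|[arg min_(S < [set: F] | toll_set S) #|S|]|.

Lemma toll_numberP :
  (exists2 S : {set F}, toll_set S & #|S| = toll_number) /\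
  (forall S : {set F}, toll_set S -> toll_number <= #|S|).
Proof.
by rewrite /toll_number; case: arg_minnP => [|S tS minS];
  [exact: toll_setT | split=> //; exists S].
Qed.

End Toll.

(* Main.v *)
Require Import Defs.
From mathcomp Require Import all_boot.
From mathcomp Require Import boolp.

(** The toll number is submultiplicative for the lexicographic product:
    tn(G o H) <= tn(G) * tn(H).  Combined with tn(G o H) = 3 * tn(G) and
    tn(G) > 0, this gives tn(H) >= 3.

    For submultiplicativity, let S and T be toll sets of G and H; then the
    product S x T is a toll set of G o H.  Whether a sequence is a tolled walk
    depends only on equalities and adjacencies between its vertices, so an
    induced embedding of graphs carries toll intervals into toll intervals
    ([toll_interval_embed]).  Two kinds of induced embeddings into G o H cover
    a vertex (g, h):
    - if g is in S, the copy {g} x H of H, in which (g, h) is between two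
      vertices of {g} x T;
    - if g is not in S, a section x |-> (x, s x) of the projection onto G, where
      s g = h and s is constantly some t in T elsewhere.  Every section is
      an induced embedding, and since g is not in S this one maps S into
      S x {t}, so a tolled walk of G through g that joins two vertices of S lifts
      to one through (g, h) that joins two vertices of S x T. *)

Section Embedding.
Variables (F1 F2 : sgraph) (f : F1 -> F2).
Hypotheses (f_inj : injective f)
           (f_adj : forall x y, adj (f x) (f y) = adj x y).

Lemma tolled_walk_embed (u v : F1) (p : seq F1) :
  tolled_walk u v p -> tolled_walk (f u) (f v) (map f p).
Proof.
rewrite /tolled_walk (inj_eq f_inj) f_adj.
case: eqP => [_ -> //|_]; case: ifP => [_ -> //|_].
case=> w -> [w_gt0 w_path w_u w_v]; exists (map f w).
  by rewrite /= map_rcons.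
split; rewrite ?size_map // => i lt_i.
- by rewrite !(nth_map u) ?(ltnW lt_i) // f_adj; exact: w_path.
- by rewrite (nth_map u) // f_adj; exact: w_u.
- by rewrite (nth_map u) // f_adj; exact: w_v.
Qed.

Lemma toll_interval_embed (u v x : F1) :
  x \in toll_interval u v -> f x \in toll_interval (f u) (f v).
Proof.
rewrite !inE => /asboolP[p p_walk xp]; apply/asboolP.
by exists (map f p); [exact: tolled_walk_embed | exact: map_f].
Qed.

End Embedding.

Lemma toll_setP (F : sgraph) (S : {set F}) :
  reflect (forall x, exists u v, [/\ u \in S, v \in S & x \in toll_interval u v])
          (toll_set S).
Proof.
apply: (iffP eqP) => [S_cover x | S_cover].
  have: x \in [set: F] by rewrite in_setT.
  by rewrite -S_cover => /bigcupP[u uS /bigcupP[v vS xuv]]; exists u, v.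
apply/setP => x; rewrite in_setT; have [u [v [uS vS xuv]]] := S_cover x.
by apply/bigcupP; exists u => //; apply/bigcupP; exists v.
Qed.

Lemma toll_set_gt0 (F : sgraph) (S : {set F}) :
  0 < #|F| -> toll_set S -> 0 < #|S|.
Proof.
case/card_gt0P => x _ /toll_setP/(_ x)[u [_ [uS _ _]]].
by apply/card_gt0P; exists u.
Qed.

Lemma toll_number_gt0 (F : sgraph) : 0 < #|F| -> 0 < toll_number F.
Proof.
by move=> F_gt0; have [[S tS <-] _] := toll_numberP F; exact: toll_set_gt0.
Qed.

Section LexEmbeddings.
Variables G H : sgraph.

Lemma lex_fiber_adj (g : G) (x y : H) :
  @adj (lex_prod G H) (g, x) (g, y) = adj x y.
Proof. by rewrite /= /lex_adj /= adj_irr eqxx. Qed.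

(** The second disjunct of the lexicographic adjacency needs equal first
    components, and two vertices of a section with equal first components
    coincide; hence only the adjacency in G counts. *)
Lemma lex_section_adj (s : G -> H) (x y : G) :
  @adj (lex_prod G H) (x, s x) (y, s y) = adj x y.
Proof.
rewrite /= /lex_adj /=; case: eqP => [->|_]; last by rewrite orbF.
by rewrite !adj_irr.
Qed.

End LexEmbeddings.

Lemma toll_set_lex_prod (G H : sgraph) (S : {set G}) (T : {set H}) :
  toll_set S -> toll_set T -> @toll_set (lex_prod G H) (setX S T).
Proof.
move=> /toll_setP S_toll /toll_setP T_toll; apply/toll_setP => -[g h].
have [t [t' [tT t'T h_tt']]] := T_toll h.
have [gS | gNS] := boolP (g \in S).
  exists (g, t), (g, t'); split; rewrite ?in_setX ?gS //.
  apply: (@toll_interval_embed H (lex_prod G H) (fun y => (g, y))) => //.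
    by move=> y z [].
  by move=> y z; exact: lex_fiber_adj.
have [u [v [uS vS g_uv]]] := S_toll g.
pose s x := if x == g then h else t.
have s_S x : x \in S -> s x = t.
  by rewrite /s; case: eqP => // ->; rewrite (negPf gNS).
exists (u, s u), (v, s v); split; rewrite ?in_setX ?s_S ?uS ?vS //.
have -> : (g, h) = (g, s g) by rewrite /s eqxx.
rewrite -{1}(s_S u uS) -(s_S v vS).
apply: (@toll_interval_embed G (lex_prod G H) (fun x => (x, s x))) => //.
  by move=> x y [].
by move=> x y; exact: lex_section_adj.
Qed.

Lemma toll_number_lex_prod (G H : sgraph) :
  toll_number (lex_prod G H) <= toll_number G * toll_number H.
Proof.
have [[S S_toll <-] _] := toll_numberP G.
have [[T T_toll <-] _] := toll_numberP H.
have [_ tn_min] := toll_numberP (lex_prod G H).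
by rewrite -cardsX; apply: tn_min; exact: toll_set_lex_prod.
Qed.

Theorem lemma4p15 (G H : sgraph)
  (Gconn : connected G) (Gnontriv : nontrivial G)
  (Hconn : connected H) (Hnontriv : nontrivial H)
  (Hncomplete : ~ complete H)
  (tnGH : toll_number (lex_prod G H) = 3 * toll_number G) :
  2 < toll_number H.
Proof.
have := toll_number_lex_prod G H.
rewrite tnGH mulnC leq_pmul2l //.
by apply: toll_number_gt0; exact: ltnW Gnontriv.
Qed.
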